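(* Let $a$ and $d$ be integers with $a\ge 3$, $d>0$ and $\gcd(a,d)=1$. For a nonnegative integer $n$ let $d(n)$ be the number of triples $(x_1,x_2,x_3)$ of nonnegative integers with $a x_1+(a+d)x_2+(a+2d)x_3=n$, and for an integer $p\ge0$ let $s_p(a,a+d,a+2d)=\sum n$, the sum over all nonnegative integers $n$ with $d(n)\le p$. Then for $0\le p\le\lfloor a/2\rfloor$: if $a$ is odd, $$s_p(a,a+d,a+2d)=\frac{(a-1)(a+2d-1)(a^2+2ad-a-d-2)}{24}+\frac{3a^3+9a^2(d-1)+2a(3d^2-9d+1)-6d^2+2d}{6}\,p+\frac{3a^2+a(6d-1)+4d^2-d}{2}\,p^2-\frac{4(a+d)}{3}\,p^3;$$ if $a$ is even, $$s_p(a,a+d,a+2d)=\frac{(a-1)(a+2d-1)(a^2+2ad-a-d-2)+3(a^2+2ad-a-d)}{24}+\frac{3a^3+9a^2(d-1)+a(6d^2-18d+5)-6d^2+5d}{6}\,p+\frac{3a^2+a(6d-1)+4d^2-d}{2}\,p^2-\frac{4(a+d)}{3}\,p^3.$$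
   Context: $s_p$ is the $p$-Sylvester sum: the sum of all nonnegative integers having at most $p$ representations as nonnegative integer combinations of $a,a+d,a+2d$. *)

(* Defs.v *)
From mathcomp Require Import all_boot all_order all_algebra.
From mathcomp Require Import boolp classical_sets functions cardinality fsbigop.

Set Implicit Arguments.
Unset Strict Implicit.
Unset Printing Implicit Defensive.

Import GRing.Theory.

(* Number of triples (x1, x2, x3) of nonnegative integers with
   a1 x1 + a2 x2 + a3 x3 = n.  The search box [0, n]^3 loses no triple when
   a1, a2, a3 > 0: see denumerant_box. *)
Definition denumerant (a1 a2 a3 n : nat) : nat :=
  #|[pred x : 'I_n.+1 * 'I_n.+1 * 'I_n.+1 |
      a1 * x.1.1 + a2 * x.1.2 + a3 * x.2 == n]|.

Lemma denumerant_box (a1 a2 a3 n x1 x2 x3 : nat) :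
  0 < a1 -> 0 < a2 -> 0 < a3 -> a1 * x1 + a2 * x2 + a3 * x3 = n ->
  [/\ x1 < n.+1, x2 < n.+1 & x3 < n.+1].
Proof.
move=> a1_gt0 a2_gt0 a3_gt0 <-; rewrite !ltnS; split.
- by rewrite -addnA (leq_trans (leq_pmull x1 a1_gt0)) ?leq_addr.
- by rewrite addnAC (leq_trans (leq_pmull x2 a2_gt0)) ?leq_addl.
- by rewrite (leq_trans (leq_pmull x3 a3_gt0)) ?leq_addl.
Qed.

Local Open Scope classical_set_scope.

Definition sylvester_set (p a1 a2 a3 : nat) : set nat :=
  [set n | denumerant a1 a2 a3 n <= p].

(* A finitely supported sum: it defaults to 0 when the nonzero elements of the
   index set are infinitely many, which sylvester_set_finite excludes for the
   generators a, a + d, a + 2 d with gcd(a, d) = 1. *)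
Definition sylvester_sum (p a1 a2 a3 : nat) : nat :=
  (\sum_(n \in sylvester_set p a1 a2 a3) n)%R.

Lemma sylvester_set_finite (p a d : nat) :
  0 < a -> 0 < d -> coprime a d ->
  finite_set (sylvester_set p a (a + d) (a + 2 * d)).
Proof.
move=> a_gt0 d_gt0 co_ad; set b := a + d.
have b_gt0 : 0 < b by rewrite addn_gt0 a_gt0.
have co_ab : coprime a b by rewrite /coprime gcdnDl.
apply: (@sub_finite_set _ _ `I_(a * b * p.+1)); last exact: finite_II.
move=> n /= n_le; rewrite ltnNge; apply/negP => n_ge.
have [u u_lt u_eq] : exists2 u, u < b & a * u = n %[mod b].
  exists ((chinese a b 0 n %/ a) %% b); first by rewrite ltn_mod.
  rewrite modnMmr mulnC divnK ?chinese_modr //.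
  by rewrite /dvdn (chinese_modl co_ab) mod0n.
have x1_le (k : 'I_p.+1) : a * (u + k * b) <= n.
  apply: leq_trans n_ge; rewrite -mulnA leq_pmul2l //.
  rewrite [b * _]mulnC (@leq_trans (k.+1 * b)) ?leq_pmul2r ?ltn_ord //.
  by rewrite mulSn leq_add2r ltnW.
pose x2 (k : 'I_p.+1) := (n - a * (u + k * b)) %/ b.
have sol (k : 'I_p.+1) : a * (u + k * b) + b * x2 k = n.
  rewrite [b * _]mulnC divnK ?subnKC //.
  by rewrite -eqn_mod_dvd // mulnDr mulnA addnC modnMDl u_eq.
pose f (k : 'I_p.+1) : 'I_n.+1 * 'I_n.+1 * 'I_n.+1 :=
  (inord (u + k * b), inord (x2 k), ord0).
have x1_lt (k : 'I_p.+1) : u + k * b < n.+1.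
  by rewrite ltnS -(sol k) (leq_trans (leq_pmull _ a_gt0)) ?leq_addr.
have f_inj : injective f.
  move=> k l [/(congr1 val) /=]; rewrite !inordK // => /eqP.
  by rewrite eqn_add2l eqn_pmul2r // => /eqP/val_inj.
move: n_le; rewrite /sylvester_set /= leqNgt => /negP; apply.
rewrite -[X in X <= _]card_ord -(card_codom f_inj) subset_leq_card //.
apply/fintype.subsetP => _ /codomP[k ->]; rewrite inE /= muln0 addn0 !inordK //.
  by rewrite sol.
by rewrite ltnS -[X in _ <= X](sol k) (leq_trans (leq_pmull _ b_gt0)) ?leq_addl.
Qed.

(* Main.v *)
(* Write n = a t + d m with t = x1 + x2 + x3 and m = x2 + 2 x3.  Given (t, m),
   a representation is determined by floor(x2 / 2), and there are
   min(t - ceil(m / 2), floor(m / 2)) + 1 of them when m <= 2 t.  If n = a T + d r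
   with 0 <= r < a, the pairs (t, m) that occur are (T - d k, r + a k), k >= 0;
   for p <= a / 2 only k = 0 and k = 1 matter at the level T where the number of
   representations of n first exceeds p.  This gives the least element of each
   residue class with more than p representations (the p-Apery set), and
   Selmer's formula turns its first two power sums into the Sylvester sum. *)
Require Import Defs.
From mathcomp Require Import all_boot all_order all_algebra.
From mathcomp Require Import fsbigop.
From mathcomp Require Import zify ring.

Set Implicit Arguments.
Unset Strict Implicit.
Unset Printing Implicit Defensive.

(** * Bounding the number of representations by injections *)

Lemma denumerant_le (a1 a2 a3 n p : nat) (f : nat -> nat -> nat -> nat) :
  (forall x y z, a1 * x + a2 * y + a3 * z = n -> f x y z < p) ->
  (forall x y z x' y' z', a1 * x + a2 * y + a3 * z = n ->
     a1 * x' + a2 * y' + a3 * z' = n -> f x y z = f x' y' z' ->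
     [/\ x = x', y = y' & z = z']) ->
  denumerant a1 a2 a3 n <= p.
Proof.
move=> f_lt f_inj; rewrite /denumerant cardE; set s := enum _.
pose g (x : 'I_n.+1 * 'I_n.+1 * 'I_n.+1) := f x.1.1 x.1.2 x.2.
have sP x : x \in s -> a1 * x.1.1 + a2 * x.1.2 + a3 * x.2 = n.
  by rewrite mem_enum inE => /eqP.
rewrite -(size_map g) -[p in _ <= p](size_iota 0) uniq_leq_size //.
  rewrite map_inj_in_uniq ?enum_uniq // => -[[x y] z] [[x' y'] z'].
  move=> /sP /= xn /sP /= x'n /(f_inj _ _ _ _ _ _ xn x'n)[].
  by do 3![move=> /val_inj ->].
by move=> _ /mapP[x /sP xn ->]; rewrite mem_iota add0n f_lt.
Qed.

Lemma denumerant_gt (a1 a2 a3 n p : nat) (f : nat -> nat * nat * nat) :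
  0 < a1 -> 0 < a2 -> 0 < a3 ->
  (forall i, i <= p -> a1 * (f i).1.1 + a2 * (f i).1.2 + a3 * (f i).2 = n) ->
  {in leq^~ p &, injective f} ->
  p < denumerant a1 a2 a3 n.
Proof.
move=> a1_gt0 a2_gt0 a3_gt0 f_sol f_inj.
pose g (i : 'I_p.+1) : 'I_n.+1 * 'I_n.+1 * 'I_n.+1 :=
  (inord (f i).1.1, inord (f i).1.2, inord (f i).2).
have gE (i : 'I_p.+1) :
    (val (g i).1.1, val (g i).1.2, val (g i).2) = f i.
  have [*] := denumerant_box a1_gt0 a2_gt0 a3_gt0 (f_sol i (leq_ord i)).
  by rewrite /= !inordK // -!surjective_pairing.
have g_inj : injective g.
  move=> i j gij; apply: val_inj; apply: f_inj; rewrite ?[_ \in _]leq_ord //.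
  by rewrite -!gE gij.
rewrite -[p.+1]card_ord -(card_codom g_inj) subset_leq_card //.
apply/subsetP => _ /codomP[i ->]; rewrite inE.
by have := f_sol i (leq_ord i); rewrite -gE /= => ->.
Qed.

(** * Sums below a bound in each residue class *)

(** With m = q a + s, the terms are s, s + a, ..., s + (q - 1) a, whose sum S satisfies 2 a S = (m^2
    - s^2) - a (m - s); the terms are moved across to avoid subtraction in [nat]. *)
Lemma sum_congr_below (a m : nat) : 0 < a ->
  2 * a * (\sum_(0 <= n < m | n == m %[mod a]) n) + (m %% a) ^ 2 + a * m
    = m ^ 2 + a * (m %% a).
Proof.
move=> a_gt0; rewrite (divn_eq m a) modnMDl modn_mod.
move: (m %/ a) (m %% a) (ltn_pmod m a_gt0) => q s s_lt.
elim: q => [|q IHq].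
  rewrite mul0n add0n big_nat_cond big1 ?muln0 ?add0n // => n.
  case/andP=> /= n_lt; rewrite !modn_small //; first by lia.
  by apply: ltn_trans s_lt.
rewrite (@big_cat_nat _ _ _ (q * a + s)) //=; last by rewrite mulSn; lia.
(* Among [a] consecutive integers starting in the class, only the first belongs to it. *)
have -> : \sum_(q * a + s <= n < q.+1 * a + s | n %% a == s) n = q * a + s.
  rewrite big_ltn_cond; last by rewrite mulSn; lia.
  rewrite modnMDl modn_small // eqxx big_nat_cond big1 ?addn0 // => n.
  case/andP=> /andP[n_gt n_lt] /eqP n_s; move: n_gt n_lt.
  by rewrite (divn_eq n a) n_s !ltn_add2r !ltn_pmul2r // => q_lt; rewrite ltnS leqNgt q_lt.
move: IHq; set S := \sum_(_ <= n < _ | _) _; rewrite mulSn; nia.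
Qed.

(** Injectivity on [a] indices makes the [m r] a full system of residues, so the integers to be
    summed split into one initial segment per class. *)
Lemma sylvester_sum_below (p a1 a2 a3 a : nat) (m : 'I_a -> nat) :
  0 < a -> injective (fun r => m r %% a) ->
  (forall r n, n = m r %[mod a] -> (denumerant a1 a2 a3 n <= p) = (n < m r)) ->
  sylvester_sum p a1 a2 a3 =
    \sum_(r < a) \sum_(0 <= n < m r | n == m r %[mod a]) n.
Proof.
move=> a_gt0 m_inj mP.
pose h r := Ordinal (ltn_pmod (m r) a_gt0).
have h_inj : injective h by move=> r s /(congr1 val) /m_inj.
(* [q n] is the index of the residue class of [n]. *)
pose q n := invF h_inj (Ordinal (ltn_pmod n a_gt0)).
have qP n r : (q n == r) = (n == m r %[mod a]).
  by rewrite -(inj_eq h_inj) f_invF -val_eqE.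
pose N := \max_(r < a) m r.
have m_le r : m r <= N by apply: leq_bigmax.
have belowE n : (denumerant a1 a2 a3 n <= p) = (n < m (q n)).
  by apply: mP; apply/eqP; rewrite -qP.
rewrite /sylvester_sum (@fsbig_fwiden _ _ _ _ [seq n <- index_iota 0 N | n < m (q n)]).
- rewrite big_filter (partition_big q xpredT) //=; apply: eq_bigr => r _.
  rewrite [RHS](big_nat_widen _ _ N) //; apply: eq_bigl => n.
  by rewrite -qP andbC; case: eqP => [->|].
- move=> n; rewrite /sylvester_set /= belowE mem_filter mem_index_iota => n_lt.
  by rewrite n_lt (leq_trans n_lt).
- by rewrite filter_uniq ?iota_uniq.
- by move=> n [/=]; rewrite mem_filter /sylvester_set /= belowE => /andP[->].
Qed.

(** * The p-Apery set of a, a + d, a + 2d *)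

(* The least T such that a T + d r has more than p representations; when
   r < 2 p, the k = 0 pair contributes only r./2 + 1 of them. *)
Definition apery_level (p a d r : nat) : nat :=
  if 2 * p <= r then p + uphalf r else d + uphalf (r + a) + (p - (r./2).+1).

Definition apery (p a d r : nat) : nat := a * apery_level p a d r + d * r.

(** Modulo [a] the equation says d (y + 2z) = d r, and d is invertible. The slack [j] serves
    integers lying j multiples of [a] below a t + d r. *)
Lemma level_decomposition (a d r t x y z j : nat) :
  coprime a d -> r < a ->
  a * x + (a + d) * y + (a + 2 * d) * z + a * j = a * t + d * r ->
  exists2 k, y + 2 * z = r + a * k & x + y + z + j + d * k = t.
Proof.
move=> co_ad r_lt E; have a_gt0 : 0 < a by case: a r_lt {co_ad E}.
have {}E : a * (x + y + z + j) + d * (y + 2 * z) = a * t + d * r by rewrite -E; ring.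
have r_eq : (y + 2 * z) %% a = r.
  have /eqP : d * (y + 2 * z) == d * r %[mod a].
    by rewrite -(modnMDl (x + y + z + j)) -[in eqbRHS](modnMDl t) ![_ * a]mulnC E.
  move: (y + 2 * z) => m {E} E.
  rewrite -[RHS](modn_small r_lt); apply/eqP.
  wlog le_rm: m r E {r_lt} / r <= m.
    by case: (leqP r m) => [|/ltnW] h W; [|rewrite eq_sym]; apply: W.
  rewrite eqn_mod_dvd // -(Gauss_dvdr _ co_ad) mulnBr -eqn_mod_dvd ?E //.
  by rewrite leq_mul2l le_rm orbT.
have mE : y + 2 * z = r + a * ((y + 2 * z) %/ a).
  by rewrite [LHS](divn_eq _ a) r_eq addnC mulnC.
exists ((y + 2 * z) %/ a) => //; apply/eqP; rewrite -(eqn_pmul2l a_gt0).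
move: E {r_eq}; move: (_ %/ a) mE => k -> E; apply/eqP.
by apply: (@addIn (d * r)); rewrite -E; ring.
Qed.

(** A pair with k >= 2 needs x + y + z >= (r + 2a)/2 on top of the cost d k, which exceeds the level
    because 2p <= a; likewise k = 1 is excluded when 2p <= r. *)
Lemma denumerant_lt_apery (p a d r j : nat) (n : nat) :
  coprime a d -> 0 < d -> 2 * p <= a -> r < a ->
  n + a * j.+1 = apery p a d r -> denumerant a (a + d) (a + 2 * d) n <= p.
Proof.
move=> co_ad d_gt0 le_pa r_lt nE.
have sol x y z : a * x + (a + d) * y + (a + 2 * d) * z = n ->
    x + y + z + j.+1 = apery_level p a d r /\ y + 2 * z = r \/
    [/\ x + y + z + j.+1 + d = apery_level p a d r, y + 2 * z = r + a & r < 2 * p].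
  move=> nE'; move: nE; rewrite -nE' /apery.
  case/(level_decomposition co_ad r_lt) => -[|[|k]] mE tE.
  - by left; split; lia.
  - by right; move: tE; rewrite /apery_level; case: leqP => *; split; lia.
  - have ak_ge : a * 2 <= a * k.+2 by rewrite leq_mul2l orbT.
    have dk_ge : d * 2 <= d * k.+2 by rewrite leq_mul2l orbT.
    move: tE mE ak_ge dk_ge; move: (a * k.+2) (d * k.+2) => ak dk.
    by rewrite /apery_level; case: leqP => *; lia.
(* For fixed k the parity of y is known, so [y./2] determines the solution. Those with k = 0 have y
   + 2z = r < a and use codes up to [r./2]; those with k = 1 are shifted past them. *)
apply: (@denumerant_le _ _ _ _ _
  (fun x y z => if y + 2 * z < a then y./2 else (r./2).+1 + y./2)).
- move=> x y z /sol; rewrite /apery_level.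
  by case: (leqP (2 * p) r) => ? [[tE mE]|[tE mE ?]]; case: (ltnP (y + _)) => ?; lia.
- by move=> x y z x' y' z' /sol [[tE mE]|[tE mE ?]] /sol [[tE' mE']|[tE' mE' ?]];
    case: ltnP => ?; case: ltnP => ? ?; split; lia.
Qed.

Lemma denumerant_ge_apery (p a d r j : nat) :
  0 < a -> 0 < d -> 2 * p <= a -> r < a ->
  p < denumerant a (a + d) (a + 2 * d) (apery p a d r + a * j).
Proof.
move=> a_gt0 d_gt0 le_pa r_lt; pose t := apery_level p a d r + j.
(* The k = 0 solutions come first, then the k = 1 ones. In each family z decreases from its largest
   value, which keeps y + z small; the level is just high enough for every truncated subtraction to
   be exact when i <= p. *)
pose f i := if i <= r./2 then (t + (r./2 - i) - r, r - 2 * (r./2 - i), r./2 - i)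
  else let z := (r + a)./2 - (i - (r./2).+1) in
    (t + z - (d + r + a), (r + a) - 2 * z, z).
apply: (denumerant_gt (f := f)); rewrite ?addn_gt0 ?a_gt0 //.
- move=> i le_ip; have -> : apery p a d r + a * j = a * t + d * r.
    by rewrite /apery /t; ring.
  rewrite /f; case: leqP => i_r /=.
    have : t + (r./2 - i) - r + (r - 2 * (r./2 - i)) + (r./2 - i) = t.
      by rewrite /t /apery_level; case: leqP; lia.
    have : r - 2 * (r./2 - i) + 2 * (r./2 - i) = r by lia.
    by move: (r./2 - i) (r - _) (_ + _ - r) => z y x <- <-; ring.
  set z := (r + a)./2 - _.
  have : t + z - (d + r + a) + (r + a - 2 * z) + z + d = t.
    by rewrite /z /t /apery_level; case: leqP; lia.
  have : r + a - 2 * z + 2 * z = r + a by rewrite /z; lia.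
  move: (z) (r + a - _) (_ - (d + r + a)) => {}z y x; nia.
- move=> i i' le_ip le_i'p; rewrite -!topredE /= in le_ip le_i'p; rewrite /f.
  by case: leqP => ?; case: leqP => ? [] *; lia.
Qed.

Lemma denumerant_apery (p a d r n : nat) :
  coprime a d -> 0 < d -> 2 * p <= a -> r < a -> n = apery p a d r %[mod a] ->
  (denumerant a (a + d) (a + 2 * d) n <= p) = (n < apery p a d r).
Proof.
move=> co_ad d_gt0 le_pa r_lt /eqP nE; have a_gt0 : 0 < a by lia.
case: (ltnP n (apery p a d r)) => [n_lt | n_ge].
  move: nE; rewrite eq_sym eqn_mod_dvd ?(ltnW n_lt) // => /dvdnP[[|j] jE]; first by lia.
  by apply: (@denumerant_lt_apery p a d r j) => //; lia.
move: nE; rewrite eqn_mod_dvd // => /dvdnP[j jE]; apply/negbTE; rewrite -ltnNge.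
by rewrite -(subnKC n_ge) jE (mulnC j) denumerant_ge_apery.
Qed.
Lemma apery_mod_inj (p a d : nat) :
  coprime a d -> {in gtn a &, injective (fun r => apery p a d r %% a)}.
Proof.
move=> co_ad r s r_lt s_lt; rewrite -!topredE /= in r_lt s_lt.
rewrite /apery ![a * _]mulnC !modnMDl.
wlog le_sr: r s r_lt s_lt / s <= r.
  move=> W E; case: (leqP s r) => [|/ltnW] le_sr; first exact: W.
  by apply/esym/W.
move/eqP; rewrite eqn_mod_dvd ?leq_mul // -mulnBr (Gauss_dvdr _ co_ad) => /dvdn_leq.
by lia.
Qed.

(** * Rational power sums and Selmer's formula *)

Local Open Scope ring_scope.
Import GRing.Theory Num.Theory.

Lemma sum_id (n : nat) : (\sum_(i < n) i%:R : rat) = n%:R * (n%:R - 1) / 2.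
Proof.
elim: n => [|n IHn]; first by rewrite big_ord0 !mul0r.
by rewrite big_ord_recr /= IHn -natr1; field.
Qed.

Lemma sum_sqr (n : nat) :
  (\sum_(i < n) i%:R ^+ 2 : rat) = n%:R * (n%:R - 1) * (2 * n%:R - 1) / 6.
Proof.
elim: n => [|n IHn]; first by rewrite big_ord0 !mul0r.
by rewrite big_ord_recr /= IHn -natr1; field.
Qed.

Lemma sum_quadratic (n : nat) (f : nat -> rat) (u v w : rat) :
  (forall i, (i < n)%N -> f i = u + v * i%:R + w * i%:R ^+ 2) ->
  \sum_(i < n) f i = u * n%:R + v * (n%:R * (n%:R - 1) / 2)
    + w * (n%:R * (n%:R - 1) * (2 * n%:R - 1) / 6).
Proof.
move=> fE; rewrite (eq_bigr (fun i : 'I_n => u + v * i%:R + w * i%:R ^+ 2)).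
  rewrite !big_split /= -!mulr_sumr sum_id sum_sqr sumr_const card_ord.
  by rewrite -(mulr_natr u).
by move=> i _; apply: fE.
Qed.

(* Selmer's formula, with [m r] in the role of the Apery set: the residues of
   the [m r] run over all classes modulo [a]. *)
Lemma sum_below_residues (a : nat) (m : 'I_a -> nat) :
  (0 < a)%N -> injective (fun r => m r %% a)%N ->
  (\sum_(r < a) \sum_(0 <= n < m r | n == m r %[mod a]) n)%N%:R =
  (\sum_(r < a) (m r)%:R ^+ 2) / (2 * a%:R) - (\sum_(r < a) (m r)%:R) / 2
    + (a%:R ^+ 2 - 1) / 12 :> rat.
Proof.
move=> a_gt0 m_inj; have a_neq0 : a%:R != 0 :> rat by rewrite pnatr_eq0 -lt0n.
pose h r := Ordinal (ltn_pmod (m r) a_gt0).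
have h_inj : injective h by move=> r s /(congr1 val) /m_inj.
have sE (r : 'I_a) : (\sum_(0 <= n < m r | n == m r %[mod a]) n)%N%:R =
    (m r)%:R ^+ 2 / (2 * a%:R) - (m r)%:R / 2
    + ((h r)%:R / 2 - (h r)%:R ^+ 2 / (2 * a%:R)) :> rat.
  have /(congr1 (fun n => n%:R : rat)) := sum_congr_below (m r) a_gt0.
  rewrite !natrD !natrX !natrM /=; set S := (\sum_(_ <= _ < _ | _) _)%N%:R => E.
  have {}E : S = ((m r)%:R ^+ 2 + a%:R * (m r %% a)%:R - (m r %% a)%:R ^+ 2
      - a%:R * (m r)%:R) / (2 * a%:R) by rewrite -E; field.
  by rewrite E; field.
rewrite natr_sum (eq_bigr _ (fun r _ => sE r)) !big_split /= !sumrN -!mulr_suml.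
rewrite -(reindex_inj h_inj (P := xpredT) (F := fun i : 'I_a => i%:R : rat)) /=.
rewrite -(reindex_inj h_inj (P := xpredT) (F := fun i : 'I_a => i%:R ^+ 2 : rat)) /=.
by rewrite sum_id sum_sqr; field.
Qed.

(** * Evaluation of the sums over the p-Apery set *)

(** Over the common denominator 2a, Selmer's formula weighs an Apery element m by m^2 - a m. *)
Lemma sum_affine_square (n : nat) (f : nat -> rat) (A u v : rat) :
  (forall i, (i < n)%N -> f i = u + v * i%:R) ->
  \sum_(i < n) (f i ^+ 2 - A * f i) = (u ^+ 2 - A * u) * n%:R
    + (2 * u * v - A * v) * (n%:R * (n%:R - 1) / 2)
    + v ^+ 2 * (n%:R * (n%:R - 1) * (2 * n%:R - 1) / 6).
Proof.
move=> fE; apply: (@sum_quadratic _ (fun i => f i ^+ 2 - A * f i)) => i i_lt.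
by rewrite fE //; ring.
Qed.

(** Cutting at r = 2p and by the parity of r gives four blocks, on each of which the Apery element
    is affine in i. *)
Lemma sum_parity_split (p e : nat) (f : nat -> rat) :
  \sum_(r < 2 * (p + e)) f r =
    \sum_(i < p) f (2 * i)%N + \sum_(i < p) f (2 * i).+1
    + (\sum_(i < e) f (2 * (p + i))%N + \sum_(i < e) f (2 * (p + i)).+1).
Proof.
have double n (g : nat -> rat) : \sum_(r < 2 * n) g r =
    \sum_(i < n) g (2 * i)%N + \sum_(i < n) g (2 * i).+1.
  elim: n => [|n IHn]; first by rewrite muln0 !big_ord0 addr0.
  by rewrite mulnS !big_ord_recr /= IHn; ring.
rewrite mulnDr big_split_ord /= double; congr (_ + _).
rewrite (double e (fun r => f (2 * p + r)%N)).
by congr (_ + _); apply: eq_bigr => i _; rewrite ?addnS mulnDr.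
Qed.

Lemma apery_natr (p a d r : nat) :
  (apery p a d r)%:R = a%:R * (apery_level p a d r)%:R + d%:R * r%:R :> rat.
Proof. by rewrite /apery natrD !natrM. Qed.

Lemma sylvester_sum_arith (p a d : nat) :
  coprime a d -> (0 < a)%N -> (0 < d)%N -> (2 * p <= a)%N ->
  (sylvester_sum p a (a + d) (a + 2 * d))%:R =
    (\sum_(r < a) ((apery p a d r)%:R ^+ 2 - a%:R * (apery p a d r)%:R)) /
      (2 * a%:R) + (a%:R ^+ 2 - 1) / 12 :> rat.
Proof.
move=> co_ad a_gt0 d_gt0 le_pa; have a_neq0 : a%:R != 0 :> rat by rewrite pnatr_eq0 -lt0n.
pose m (r : 'I_a) := apery p a d r.
have m_inj : injective (fun r => m r %% a)%N.
  move=> r s; rewrite /m => E; apply/val_inj.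
  by apply: (apery_mod_inj co_ad) E; rewrite -topredE /= ltn_ord.
rewrite (sylvester_sum_below (m := m)) //; last first.
  by move=> r n; apply: denumerant_apery.
rewrite sum_below_residues // sumrB -mulr_sumr; congr (_ + _).
by field.
Qed.

(** For r >= 2p the Apery elements do not depend on the parity of [a]. For r < 2p the level is
    constant on each parity class of r, hence the slope 2d, but the initial values [u] and [w]
    depend on that parity and stay parameters. *)
Lemma sum_apery_below (p e a d : nat) (u w : rat) :
  let A : rat := a%:R in let D : rat := d%:R in
  let P : rat := p%:R in let E : rat := e%:R in
  let sum_square (u v k : rat) := (u ^+ 2 - A * u) * k
    + (2 * u * v - A * v) * (k * (k - 1) / 2)
    + v ^+ 2 * (k * (k - 1) * (2 * k - 1) / 6) in
  (forall i, (i < p)%N -> (apery p a d (2 * i))%:R = u + 2 * D * i%:R) ->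
  (forall i, (i < p)%N -> (apery p a d (2 * i).+1)%:R = w + 2 * D * i%:R) ->
  \sum_(r < 2 * (p + e)) ((apery p a d r)%:R ^+ 2 - A * (apery p a d r)%:R) =
    sum_square u (2 * D) P + sum_square w (2 * D) P
    + (sum_square (2 * (A + D) * P) (A + 2 * D) E
       + sum_square (2 * (A + D) * P + A + D) (A + 2 * D) E).
Proof.
move=> A D P E sum_square uE wE; pose m r : rat := (apery p a d r)%:R.
rewrite (sum_parity_split p e (fun r => m r ^+ 2 - A * m r)).
rewrite (sum_affine_square (f := fun i => m (2 * i)%N) _ uE).
rewrite (sum_affine_square (f := fun i => m (2 * i).+1) _ wE).
rewrite (@sum_affine_square _ (fun i => m (2 * (p + i))%N) _ (2 * (A + D) * P) (A + 2 * D));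
  last first.
  move=> i _; rewrite /m apery_natr.
  have -> : apery_level p a d (2 * (p + i)) = (p + (p + i))%N.
    by rewrite /apery_level; case: leqP; lia.
  by rewrite natrM !natrD; ring.
rewrite (@sum_affine_square _ (fun i => m (2 * (p + i)).+1) _
  (2 * (A + D) * P + A + D) (A + 2 * D)) //.
move=> i _; rewrite /m apery_natr.
have -> : apery_level p a d (2 * (p + i)).+1 = (p + (p + i) + 1)%N.
  by rewrite /apery_level; case: leqP; lia.
by rewrite -[(2 * _).+1]addn1 !(natrM, natrD); ring.
Qed.

Lemma sylvester_sum_even (p e d : nat) :
  let a := (2 * (p + e))%N in
  coprime a d -> (0 < a)%N -> (0 < d)%N ->
  let A : rat := a%:R in let D : rat := d%:R in let P : rat := p%:R in
  (sylvester_sum p a (a + d) (a + 2 * d))%:R =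
    ((A - 1) * (A + 2 * D - 1) * (A ^+ 2 + 2 * A * D - A - D - 2)
         + 3 * (A ^+ 2 + 2 * A * D - A - D)) / 24
      + (3 * A ^+ 3 + 9 * A ^+ 2 * (D - 1)
         + A * (6 * D ^+ 2 - 18 * D + 5) - 6 * D ^+ 2 + 5 * D) / 6 * P
      + (3 * A ^+ 2 + A * (6 * D - 1) + 4 * D ^+ 2 - D) / 2 * P ^+ 2
      - 4 * (A + D) / 3 * P ^+ 3.
Proof.
move=> a co_ad a_gt0 d_gt0 A D P.
have A_neq0 : A != 0 by rewrite pnatr_eq0 -lt0n.
have halfA : p%:R + e%:R = A / 2 by rewrite /A /a natrM natrD; field.
rewrite sylvester_sum_arith //; last by rewrite /a; lia.
rewrite (sum_apery_below e (u := A * (D + A / 2 + P - 1))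
  (w := A * (D + A / 2 + P) + D)).
- have -> : e%:R = A / 2 - P by rewrite -halfA /P; ring.
  by rewrite -/A -/D -/P; field.
- move=> i i_lt; rewrite apery_natr -/A -/D.
  (* Here [uphalf (2 * i + a)] is i + (p + e), and its i cancels against p - (i + 1). Since i < p,
     the predecessor of p is not truncated. *)
  have -> : apery_level p a d (2 * i) = (d + (p + e) + p.-1)%N.
    by rewrite /apery_level /a; case: leqP; lia.
  by rewrite -halfA -subn1 natrM !natrD natrB; [ring | lia].
- move=> i i_lt; rewrite apery_natr -/A -/D.
  have -> : apery_level p a d (2 * i).+1 = (d + (p + e) + p)%N.
    by rewrite /apery_level /a; case: leqP; lia.
  by rewrite -halfA -natr1 natrM !natrD; ring.
Qed.

Lemma sylvester_sum_odd (p e d : nat) :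
  let a := (2 * (p + e)).+1 in
  coprime a d -> (0 < d)%N ->
  let A : rat := a%:R in let D : rat := d%:R in let P : rat := p%:R in
  (sylvester_sum p a (a + d) (a + 2 * d))%:R =
    (A - 1) * (A + 2 * D - 1) * (A ^+ 2 + 2 * A * D - A - D - 2) / 24
      + (3 * A ^+ 3 + 9 * A ^+ 2 * (D - 1)
         + 2 * A * (3 * D ^+ 2 - 9 * D + 1) - 6 * D ^+ 2 + 2 * D) / 6 * P
      + (3 * A ^+ 2 + A * (6 * D - 1) + 4 * D ^+ 2 - D) / 2 * P ^+ 2
      - 4 * (A + D) / 3 * P ^+ 3.
Proof.
move=> a co_ad d_gt0 A D P.
have A_neq0 : A != 0 by rewrite pnatr_eq0.
have halfA : p%:R + e%:R = (A - 1) / 2 by rewrite /A /a -natr1 natrM natrD; field.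
rewrite sylvester_sum_arith //; last by rewrite /a; lia.
rewrite big_ord_recr /= (sum_apery_below e (u := A * (D + (A - 1) / 2 + P))
  (w := A * (D + (A - 1) / 2 + P) + D)).
(* An odd [a] leaves one residue outside the four blocks, r = a - 1 = 2(p + e), which lies in the
   range r >= 2p. *)
- have -> : (apery p a d (2 * (p + e)))%:R = A * (P + (A - 1) / 2) + D * (A - 1).
    rewrite apery_natr -/A -/D.
    have -> : apery_level p a d (2 * (p + e)) = (p + (p + e))%N.
      by rewrite /apery_level; case: leqP; lia.
    by rewrite natrM !natrD halfA -/P; field.
  have -> : e%:R = (A - 1) / 2 - P by rewrite -halfA /P; ring.
  by rewrite -/A -/D -/P; field.
- move=> i i_lt; rewrite apery_natr -/A -/D.
  have -> : apery_level p a d (2 * i) = (d + (p + e) + p)%N.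
    by rewrite /apery_level /a; case: leqP; lia.
  by rewrite -halfA natrM !natrD; ring.
- move=> i i_lt; rewrite apery_natr -/A -/D.
  have -> : apery_level p a d (2 * i).+1 = (d + (p + e) + p)%N.
    by rewrite /apery_level /a; case: leqP; lia.
  by rewrite -halfA -natr1 natrM !natrD; ring.
Qed.

Theorem theorem2 (a d p : nat) (ha : (3 <= a)%N) (hd : (0 < d)%N)
    (had : gcdn a d = 1%N) (hp : (p <= a %/ 2)%N) :
  let A : rat := a%:R in
  let D : rat := d%:R in
  let P : rat := p%:R in
  let S : rat := (sylvester_sum p a (a + d)%N (a + 2 * d)%N)%:R in
  (odd a ->
    S = (A - 1) * (A + 2 * D - 1) * (A ^+ 2 + 2 * A * D - A - D - 2) / 24
      + (3 * A ^+ 3 + 9 * A ^+ 2 * (D - 1)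
         + 2 * A * (3 * D ^+ 2 - 9 * D + 1) - 6 * D ^+ 2 + 2 * D) / 6 * P
      + (3 * A ^+ 2 + A * (6 * D - 1) + 4 * D ^+ 2 - D) / 2 * P ^+ 2
      - 4 * (A + D) / 3 * P ^+ 3) /\
  (~~ odd a ->
    S = ((A - 1) * (A + 2 * D - 1) * (A ^+ 2 + 2 * A * D - A - D - 2)
         + 3 * (A ^+ 2 + 2 * A * D - A - D)) / 24
      + (3 * A ^+ 3 + 9 * A ^+ 2 * (D - 1)
         + A * (6 * D ^+ 2 - 18 * D + 5) - 6 * D ^+ 2 + 5 * D) / 6 * P
      + (3 * A ^+ 2 + A * (6 * D - 1) + 4 * D ^+ 2 - D) / 2 * P ^+ 2
      - 4 * (A + D) / 3 * P ^+ 3).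
Proof.
have co_ad : coprime a d by rewrite /coprime had.
(* The bound on p makes floor(a/2) - p an exact difference; [e] is the length of each block above
   2p. *)
have [e aE] : exists e, (a = 2 * (p + e) + odd a)%N.
  by exists (a %/ 2 - p)%N; lia.
move=> A D P S; split=> [a_odd | /negbTE a_even].
  move: aE; rewrite a_odd addn1 => aE; rewrite /S /A aE.
  by apply: sylvester_sum_odd; rewrite -?aE.
move: aE; rewrite a_even addn0 => aE; rewrite /S /A aE.
by apply: sylvester_sum_even; rewrite -?aE //; lia.
Qed.
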